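(* Let $K$ be a compact Hausdorff space and $(f_n)_n$ a bounded sequence in $\mathcal{C}(K)$. Define, for every $t\in K$, $$b(t)=\sup\Big\{\lim_{(n,\alpha)}\ \sup_{j\ge n,\ \beta\ge\alpha} f_j(t_\beta) : (t_\alpha)_{\alpha\in\Lambda}\text{ is a net in } K \text{ converging to } t\Big\},$$ $$a(t)=\inf\Big\{\lim_{(n,\alpha)}\ \inf_{j\ge n,\ \beta\ge\alpha} f_j(t_\beta) : (t_\alpha)_{\alpha\in\Lambda}\text{ is a net in } K\text{ converging to } t\Big\},$$ where the limits are taken along the directed set $\mathbb{N}\times\Lambda$ with the product order. Then $a$ is lower semicontinuous, $b$ is upper semicontinuous, and for every $f\in\mathcal{C}(K)$ we have $$\limsup_n\|f_n-f\|=\max\{\|b-f\|,\|f-a\|\}.$$ Consequently the asymptotic radius of $(f_n)_n$ in $\mathcal{C}(K)$ is $\frac12\|b-a\|$ and its asymptotic center is the set $$\Big\{g\in\mathcal{C}(K):\ \|b-g\|=\|g-a\|=\tfrac12\|b-a\|\Big\},$$ which is nonempty.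
   Context: $\mathcal{C}(K)$ is the real Banach space of continuous functions $K\to\mathbb{R}$ with the supremum norm; $\|\cdot\|$ also denotes the supremum norm of arbitrary bounded real functions on $K$. For a bounded sequence $\bar x=(x_n)_n$ in a normed space $X$, its asymptotic radius is $ar(\bar x)=\inf_{y\in X}\limsup_n\|x_n-y\|$ and its asymptotic center is the set $ac(\bar x)=\{y\in X:\limsup_n\|x_n-y\|=ar(\bar x)\}$. *)

(* Defs.v *)
From HB Require Import structures.
From mathcomp Require Import all_boot all_order all_algebra.
From mathcomp Require Import all_classical all_reals all_analysis.

Set Implicit Arguments.
Unset Strict Implicit.
Unset Printing Implicit Defensive.

Import Order.TTheory GRing.Theory Num.Theory.
Import numFieldNormedType.Exports.

Local Open Scope classical_set_scope.
Local Open Scope ring_scope.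

Record directed_set := DirectedSet {
  dcarrier :> Type;
  dle : dcarrier -> dcarrier -> Prop;
  dle_refl : forall x, dle x x;
  dle_trans : forall y x z, dle x y -> dle y z -> dle x z;
  dle_directed : forall x y, exists z, dle x z /\ dle y z;
  d_inhabited : inhabited dcarrier }.

Section nat_directed.

Lemma nat_dle_trans (y x z : nat) : (x <= y)%N -> (y <= z)%N -> (x <= z)%N.
Proof. exact: leq_trans. Qed.

Lemma nat_dle_directed (x y : nat) : exists z, (x <= z)%N /\ (y <= z)%N.
Proof. by exists (maxn x y); rewrite leq_maxl leq_maxr. Qed.

Definition nat_directed : directed_set :=
  @DirectedSet nat (fun m n => (m <= n)%N) leqnn nat_dle_trans
    nat_dle_directed (inhabits 0%N).

End nat_directed.

Section prod_directed.
Variables D E : directed_set.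

Let ple (p q : D * E) : Prop := dle p.1 q.1 /\ dle p.2 q.2.

Lemma ple_refl p : ple p p.
Proof. by split; exact: dle_refl. Qed.

Lemma ple_trans q p r : ple p q -> ple q r -> ple p r.
Proof.
by move=> [pq1 pq2] [qr1 qr2]; split; [exact: dle_trans qr1 | exact: dle_trans qr2].
Qed.

Lemma ple_directed p q : exists r, ple p r /\ ple q r.
Proof.
have [x [px qx]] := dle_directed p.1 q.1.
have [y [py qy]] := dle_directed p.2 q.2.
by exists (x, y).
Qed.

Lemma ple_inhabited : inhabited (D * E).
Proof. by case: (d_inhabited D) (d_inhabited E) => x [y]; exists; exact: (x, y). Qed.

Definition prod_directed : directed_set :=
  @DirectedSet (D * E)%type ple ple_refl ple_trans ple_directed ple_inhabited.

End prod_directed.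

Definition tail (D : directed_set) (d : D) : set D := [set e | dle d e].

(* A net [x : D -> T] converges to [t] when [x @ tails D --> t]. *)
Definition tails (D : directed_set) : set_system D :=
  filter_from [set: D] (@tail D).

Arguments tails : clear implicits.

Section envelopes.
Context {R : realType} {K : topologicalType}.
Implicit Types (f : nat -> K -> R) (t : K).

(* For [f] uniformly bounded, the nets of suprema and infima below are bounded
   and monotone, so that every [lim], [sup] and [inf] is taken where it is
   meaningful. *)
Definition net_limsup f (D : directed_set) (x : D -> K) : R :=
  lim ((fun p : prod_directed nat_directed D =>
          sup [set f q.1 (x q.2) | q in tail p]) @ tails _).

Definition net_liminf f (D : directed_set) (x : D -> K) : R :=
  lim ((fun p : prod_directed nat_directed D =>
          inf [set f q.1 (x q.2) | q in tail p]) @ tails _).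

Definition upper_envelope f t : R :=
  sup [set r | exists (D : directed_set) (x : D -> K),
                 x @ tails D --> t /\ r = net_limsup f x].

Definition lower_envelope f t : R :=
  inf [set r | exists (D : directed_set) (x : D -> K),
                 x @ tails D --> t /\ r = net_liminf f x].

End envelopes.

(* Mirrors the library's [lower_semicontinuous]. *)
Definition upper_semicontinuous {X : topologicalType} {R : numFieldType}
    (f : X -> \bar R) :=
  forall x a, (f x < a%:E)%E ->
    exists2 V, nbhs x V & forall y, V y -> (f y < a%:E)%E.

(* If [T] is empty this is [sup set0 = 0]. *)
Definition sup_norm {R : realType} {T : Type} (g : T -> R) : R :=
  sup (range (fun t => `|g t|)).

Definition asymptotic_radius {R : realType} {X : normedModType R}
    (x : nat -> X) : R :=
  inf (range (fun y : X => limn_sup (fun n => `|x n - y|))).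

Definition asymptotic_center {R : realType} {X : normedModType R}
    (x : nat -> X) : set X :=
  [set y | limn_sup (fun n => `|x n - y|) = asymptotic_radius x].

(* The compactness proof is a parameter so that the supremum norm is finite
   and can be declared as a canonical norm. *)
Definition C {K : topologicalType} (cK : compact [set: K]) (R : realType) :
  Type := continuousType K R.

Section C_normed.
Context {K : topologicalType} (cK : compact [set: K]) (R : realType).
Local Notation CK := (C cK R).
Implicit Types f g h : CK.

Lemma C_ext f g : (forall t, f t = g t) -> f = g.
Proof. by move=> fg; apply/continuousEP. Qed.

Lemma C_add_continuous f g : continuous (fun t => f t + g t).
Proof. by move=> t; apply: cvgD; exact: cts_fun. Qed.

Lemma C_opp_continuous f : continuous (fun t => - f t).
Proof. by move=> t; apply: cvgN; exact: cts_fun. Qed.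

Lemma C_scale_continuous (c : R) f : continuous (fun t => c * f t).
Proof. by move=> t; apply: cvgM; [exact: cvg_cst | exact: cts_fun]. Qed.

Definition C_zero : CK := cst 0 : continuousType K R.
Definition C_add f g : CK := mkcts (@C_add_continuous f g) : continuousType K R.
Definition C_opp f : CK := mkcts (@C_opp_continuous f) : continuousType K R.
Definition C_scale (c : R) f : CK :=
  mkcts (@C_scale_continuous c f) : continuousType K R.

Lemma C_addA : associative C_add.
Proof. by move=> f g h; apply: C_ext => t; exact: addrA. Qed.

Lemma C_addC : commutative C_add.
Proof. by move=> f g; apply: C_ext => t; exact: addrC. Qed.

Lemma C_add0 : left_id C_zero C_add.
Proof. by move=> f; apply: C_ext => t; exact: add0r. Qed.

Lemma C_addN : left_inverse C_zero C_opp C_add.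
Proof. by move=> f; apply: C_ext => t; exact: addNr. Qed.

HB.instance Definition _ := Choice.copy CK (continuousType K R).
HB.instance Definition _ :=
  GRing.isZmodule.Build CK C_addA C_addC C_add0 C_addN.

Lemma C_scaleA (c d : R) f : C_scale c (C_scale d f) = C_scale (c * d) f.
Proof. by apply: C_ext => t; exact: mulrA. Qed.

Lemma C_scale1 : left_id 1 C_scale.
Proof. by move=> f; apply: C_ext => t; exact: mul1r. Qed.

Lemma C_scaleDr : right_distributive C_scale +%R.
Proof. by move=> c f g; apply: C_ext => t; exact: mulrDr. Qed.

Lemma C_scaleDl f : {morph C_scale^~ f : c d / c + d}.
Proof. by move=> c d; apply: C_ext => t; exact: mulrDl. Qed.

HB.instance Definition _ :=
  GRing.Zmodule_isLmodule.Build R CK C_scaleA C_scale1 C_scaleDr C_scaleDl.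

Lemma C_has_ubound f : has_ubound (range (fun t => `|f t|)).
Proof.
have cf : continuous (fun t => `|f t|).
  by move=> t; apply: cvg_norm; exact: cts_fun.
have /compact_bounded[M [_ bM]] : compact ((fun t => `|f t|) @` [set: K]).
  by apply: continuous_compact cK; exact: continuous_subspaceT.
exists (M + 1) => r rf; apply: le_trans (ler_norm r) _.
by apply: bM rf; rewrite ltrDl.
Qed.

Lemma C_norm_ge f t : `|f t| <= sup_norm f.
Proof. by apply: ub_le_sup; [exact: C_has_ubound | exists t]. Qed.

Lemma sup_norm_le (g : K -> R) (M : R) :
  0 <= M -> (forall t, `|g t| <= M) -> sup_norm g <= M.
Proof.
move=> M0 gM; have [[r rg]|] := pselect (range (fun t => `|g t|) !=set0).
  by apply: ge_sup; [exists r | move=> _ [t _ <-]].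
by move=> /set0P/negP/negPn/eqP; rewrite /sup_norm => ->; rewrite sup0.
Qed.

Lemma sup_norm_ge0 f : 0 <= sup_norm f.
Proof.
have [[t _]|K0] := pselect ([set: K] !=set0).
  exact: le_trans (normr_ge0 _) (C_norm_ge f t).
rewrite /sup_norm; suff -> : range (fun t => `|f t|) = set0 by rewrite sup0.
by rewrite -subset0 => r [t _ _]; apply: K0; exists t.
Qed.

Lemma C_normD f g : sup_norm (f + g : CK) <= sup_norm f + sup_norm g.
Proof.
apply: sup_norm_le => [|t]; first by rewrite addr_ge0 ?sup_norm_ge0.
exact: le_trans (ler_normD _ _) (lerD (C_norm_ge f t) (C_norm_ge g t)).
Qed.

Lemma C_normZ_le (c : R) f : sup_norm (c *: f : CK) <= `|c| * sup_norm f.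
Proof.
apply: sup_norm_le => [|t]; first by rewrite mulr_ge0 ?sup_norm_ge0.
rewrite [X in X <= _](normrM c (f t)).
by rewrite ler_wpM2l// C_norm_ge.
Qed.

Lemma C_normZ (c : R) f : sup_norm (c *: f : CK) = `|c| * sup_norm f.
Proof.
apply/eqP; rewrite eq_le C_normZ_le/=.
have [->|c0] := eqVneq c 0; first by rewrite normr0 mul0r sup_norm_ge0.
have := C_normZ_le c^-1 (c *: f).
by rewrite scalerA mulVf// scale1r normfV ler_pdivlMl// normr_gt0.
Qed.

Lemma C_norm0_eq0 f : sup_norm f = 0 -> f = 0.
Proof.
move=> f0; apply: C_ext => t; apply/eqP.
by rewrite -[_ == _]normr_le0 -f0 C_norm_ge.
Qed.

HB.instance Definition _ :=
  Lmodule_isNormed.Build R CK C_normD C_normZ C_norm0_eq0.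

End C_normed.

(* Main.v *)
(** The upper envelope [b] is characterised by two facts: [b t < c] forces
    [f_n s < c] for all [s] near [t] and all large [n], and [f_n s <= c] for all
    such [s] and [n] forces [b t <= c]. The first is read off the net of pairs
    [(U, s)] with [s] in the neighbourhood [U] of [t], for which the tail suprema
    are the suprema of [f_j] over [U] and [j >= n]. Semicontinuity is then
    immediate, and the formula for [limsup |f_n - g|] follows from a finite
    subcover of [K]; the lower envelope is [- b] for the sequence [- f_n].
    With [r = |b - a| / 2], every [g] has [limsup |f_n - g| >= r] by the triangle
    inequality, and a [g] attaining [r] is a continuous function with
    [b - r <= g <= a + r], which the Katetov-Tong insertion theorem provides. *)
Require Import Defs.
From mathcomp Require Import all_boot all_order all_algebra.
From mathcomp Require Import all_classical all_reals all_analysis.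
From mathcomp Require Import lra.

Set Implicit Arguments.
Unset Strict Implicit.
Unset Printing Implicit Defensive.

Import Order.TTheory GRing.Theory Num.Theory.
Import numFieldNormedType.Exports.
Local Open Scope classical_set_scope.
Local Open Scope ring_scope.

(** * Tail filters and convergence of monotone nets *)

#[local] Instance tails_proper (D : directed_set) : ProperFilter (tails D).
Proof.
apply: filter_from_proper.
  apply: filter_from_filter; first by case: (d_inhabited D) => d; exists d.
  move=> d e _ _; have [z [dz ez]] := dle_directed d e; exists z => // y zy.
  by split; [exact: dle_trans zy | exact: dle_trans zy].
by move=> d _; exists d; exact: dle_refl.
Qed.

(** The limit is the infimum of the range: an index whose value is within [e] of it controls its
    whole tail by monotonicity. *)
Lemma nonincreasing_net_is_cvg (R : realType) (D : directed_set) (u : D -> R) :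
  (forall d e, dle d e -> u e <= u d) -> has_lbound (range u) ->
  cvg (u @ tails D).
Proof.
move=> u_decr u_lb; apply/cvg_ex; exists (inf (range u)).
have u_inf : has_inf (range u).
  by split=> //; case: (d_inhabited D) => d; exists (u d), d.
apply/cvgrPdist_lt => e e0.
have [_ [d _ <-] ud] := inf_adherent e0 u_inf.
exists d => // d' dd' /=; rewrite distrC ger0_norm.
  by rewrite ltrBlDl (le_lt_trans _ ud)// u_decr.
by rewrite subr_ge0; apply: ge_inf => //; exists d'.
Qed.

(** * The universal net of pointed neighbourhoods of a point *)

Section neighborhood_net.
Context {K : topologicalType} (t : K).

(** Carrying a point besides the set, with an order that compares only the sets, makes the tail at
    [(U, s)] visit every point of [U]. *)
Record pointed_nbhs := PointedNbhs {
  pn_set : set K; pn_point : K;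
  pn_nbhs : nbhs t pn_set; pn_mem : pn_set pn_point }.

Let pnle (p q : pointed_nbhs) := pn_set q `<=` pn_set p.

Let pnle_refl p : pnle p p.
Proof. exact: subset_refl. Qed.

Let pnle_trans q p r : pnle p q -> pnle q r -> pnle p r.
Proof. by move=> pq qr; exact: subset_trans pq. Qed.

Let pnle_directed p q : exists r, pnle p r /\ pnle q r.
Proof.
have Upq : nbhs t (pn_set p `&` pn_set q) by apply: filterI; exact: pn_nbhs.
by exists (PointedNbhs Upq (nbhs_singleton Upq)); split=> s [].
Qed.

Definition nbhs_directed : directed_set :=
  DirectedSet pnle_refl pnle_trans pnle_directed
    (inhabits (PointedNbhs (@filterT _ (nbhs t) _) (I : setT t))).

Lemma nbhs_net_cvg : (pn_point : nbhs_directed -> K) @ tails nbhs_directed --> t.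
Proof.
move=> U Ut; exists (PointedNbhs Ut (nbhs_singleton Ut)) => //.
by move=> p /(_ _ (pn_mem p)).
Qed.

End neighborhood_net.

(** * The two characterising properties of the upper envelope *)

Section envelopes.
Context {R : realType} {K : topologicalType} (F : nat -> K -> R) (M : R).
Hypothesis F_bounded : forall n t, `|F n t| <= M.

Let tail_values (D : directed_set) (x : D -> K)
    (p : prod_directed nat_directed D) :=
  [set F q.1 (x q.2) | q in tail p].

Let tail_values_ub (D : directed_set) (x : D -> K) p :
  has_ubound (tail_values x p).
Proof. by exists M => _ [q _ <-]; exact: le_trans (ler_norm _) (F_bounded _ _). Qed.

Let tail_values_le (D : directed_set) (x : D -> K)
    (p q : prod_directed nat_directed D) : tail p q ->
  F q.1 (x q.2) <= sup (tail_values x p).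
Proof. by move=> pq; apply: ub_le_sup => //; exists q. Qed.

(** Makes the [lim] in [net_limsup] a genuine limit: tail suprema decrease and, each dominating some
    value of [F], stay above [- M]. *)
Lemma is_cvg_tail_sup (D : directed_set) (x : D -> K) :
  cvg ((fun p : prod_directed nat_directed D =>
    sup [set F q.1 (x q.2) | q in tail p]) @ tails (prod_directed nat_directed D)).
Proof.
apply: nonincreasing_net_is_cvg => [p q pq|].
  apply: ge_sup => [|_ [r qr <-]].
    by exists (F q.1 (x q.2)), q => //; exact: dle_refl.
  by apply: tail_values_le; exact: dle_trans qr.
exists (- M) => _ [p _ <-].
apply: le_trans (@tail_values_le D x p p (dle_refl _)).
by have := F_bounded p.1 (x p.2); rewrite ler_norml => /andP[].
Qed.

Lemma net_limsup_le (D : directed_set) (x : D -> K) (t : K) (c : R) :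
  x @ tails D --> t -> (\forall s \near t & n \near \oo, F n s <= c) ->
  net_limsup F x <= c.
Proof.
move=> xt [[U V]/= [Ut [N _ NV]] UVc].
have [d _ dU] := xt _ Ut.
apply: limr_le; first exact: is_cvg_tail_sup.
exists ((N, d) : prod_directed nat_directed D) => // p [/= Np dp].
apply: ge_sup => [|_ [q [/= pq1 pq2] <-]].
  by exists (F p.1 (x p.2)), p => //; exact: dle_refl.
apply: (UVc (x q.2, q.1)); split => /=.
  by apply: dU; exact: dle_trans pq2.
by apply: NV; exact: leq_trans pq1.
Qed.

Lemma upper_envelope_le (t : K) (c : R) :
  (\forall s \near t & n \near \oo, F n s <= c) -> upper_envelope F t <= c.
Proof.
move=> Fc; apply: ge_sup => [|_ [D [x [xt ->]]]]; last exact: net_limsup_le Fc.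
by eexists; exists (nbhs_directed t), (@pn_point _ t); split => //; exact: nbhs_net_cvg.
Qed.

Lemma upper_envelope_lt (t : K) (c : R) :
  upper_envelope F t < c -> \forall s \near t & n \near \oo, F n s < c.
Proof.
move=> btc.
have : net_limsup F (@pn_point _ t : nbhs_directed t -> K) < c.
  apply: le_lt_trans btc; apply: ub_le_sup.
    exists M => _ [D [x [xt ->]]]; apply: net_limsup_le xt _.
    by near=> n s; exact: le_trans (ler_norm _) (F_bounded _ _).
  by exists (nbhs_directed t), (@pn_point _ t); split => //; exact: nbhs_net_cvg.
move=> /(cvgr_lt _ (@is_cvg_tail_sup (nbhs_directed t) (@pn_point _ t))).
case=> -[N p] _ Npc.
exists (pn_set p, [set n | (N <= n)%N]).
  by split; [exact: pn_nbhs | exists N].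
move=> [s n] [/= ps Nn].
apply: le_lt_trans (Npc (N, p) (dle_refl _)).
(* Keeping the set of [p] and moving its point to [s] stays in the tail of [(N, p)]. *)
by apply: (@tail_values_le (nbhs_directed t) (@pn_point _ t) (N, p)
  (n, PointedNbhs (pn_nbhs p) ps)); split.
Unshelve. all: by end_near. Qed.

End envelopes.

(** * Semicontinuity of real-valued functions *)

Section real_semicontinuity.
Context {R : realType} {K : topologicalType}.
Implicit Types u g : K -> R.

Lemma upper_semicontinuous_nearP u :
  upper_semicontinuous (fun t => (u t)%:E) <->
  forall t c, u t < c -> \forall s \near t, u s < c.
Proof.
split=> [su t c utc|su t c]; last first.
  by rewrite lte_fin => utc; exists [set s | u s < c]; [exact: su|].
have [|V Vt Vc] := su t c; first by rewrite lte_fin.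
by apply: filterS Vt => s /Vc; rewrite lte_fin.
Qed.

Lemma lower_semicontinuousN u :
  lower_semicontinuous (fun t => (u t)%:E) <->
  upper_semicontinuous (fun t => (- u t)%:E).
Proof.
split=> su t c; rewrite lte_fin => ct.
  have [|V Vt Vc] := su t (- c); first by rewrite lte_fin ltrNl.
  by exists V => // s /Vc; rewrite !lte_fin ltrNl.
have [|V Vt Vc] := su t (- c); first by rewrite lte_fin ltrN2.
by exists V => // s /Vc; rewrite !lte_fin ltrN2.
Qed.

Lemma upper_semicontinuous_closed_ge u (c : R) :
  upper_semicontinuous (fun t => (u t)%:E) -> closed [set t | c <= u t].
Proof.
move=> /upper_semicontinuous_nearP su.
have -> : [set t | c <= u t] = ~` [set t | u t < c].
  by apply/seteqP; split => t /=; rewrite leNgt => /negP.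
by apply: open_closedC; rewrite openE => t; exact: su.
Qed.

Lemma upper_semicontinuousD u g :
  upper_semicontinuous (fun t => (u t)%:E) -> continuous g ->
  upper_semicontinuous (fun t => (u t + g t)%:E).
Proof.
move=> /upper_semicontinuous_nearP su cg; apply/upper_semicontinuous_nearP.
move=> t c utc; pose e := (c - (u t + g t)) / 2.
have e0 : 0 < e by rewrite /e; lra.
have ut : u t < u t + e by lra.
have gt : g t < g t + e by lra.
near=> s.
have us : u s < u t + e by near: s; exact: su.
have gs : g s < g t + e by near: s; exact: (cvgr_lt _ (cg t)).
by rewrite /e in us gs; lra.
Unshelve. all: by end_near. Qed.

End real_semicontinuity.

(** * Katetov-Tong insertion on a normal space *)

Section insertion.
Context {R : realType} {K : topologicalType}.
Hypothesis normalK : normal_space K.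
Implicit Types u v g h : K -> R.

(* The insertion theorem is proved with [v = - l], so that the upper and the
   lower bound are treated alike; one Urysohn function reduces both positive
   parts by the factor 2/3, as in the proof of Tietze's theorem. *)
Let insertion_step u v (M : R) :
  upper_semicontinuous (fun t => (u t)%:E) ->
  upper_semicontinuous (fun t => (v t)%:E) ->
  0 < M -> (forall t, u t + v t <= 0) ->
  (forall t, u t <= M) -> (forall t, v t <= M) ->
  exists g, [/\ continuous g, forall t, `|g t| <= 3^-1 * M,
    forall t, u t - g t <= 2 / 3 * M & forall t, v t + g t <= 2 / 3 * M].
Proof.
move=> su sv M0 uv uM vM; pose A := [set t | 3^-1 * M <= u t].
pose B := [set t | 3^-1 * M <= v t].
have BA0 : B `&` A = set0.
  by rewrite -subset0 /A /B => t [/= Bt At]; have := uv t; lra.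
have NMM : - (3^-1 * M) < 3^-1 * M by lra.
have [g [cg gB gA gM]] := urysohn_ext_itv normalK
  (upper_semicontinuous_closed_ge sv)
  (upper_semicontinuous_closed_ge su) BA0 NMM.
have {}gM t : - (3^-1 * M) <= g t <= 3^-1 * M by apply: gM; exists t.
exists g; split=> // t; first by rewrite ler_norml.
  have /andP[gt1 gt2] := gM t; have := uM t.
  have [ut|ut] := leP (3^-1 * M) (u t); last by lra.
  by have -> : g t = 3^-1 * M; [apply: gA; exists t|lra].
have /andP[gt1 gt2] := gM t; have := vM t.
have [vt|vt] := leP (3^-1 * M) (v t); last by lra.
by have -> : g t = - (3^-1 * M); [apply: gB; exists t|lra].
Qed.

Let geometric_small (M e : R) : 0 < M -> 0 < e ->
  exists n : nat, M * (2 / 3) ^+ n < e.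
Proof.
move=> M0 e0; have q1 : `|2 / 3| < 1 :> R by rewrite ger0_norm; lra.
have [N _ /(_ N (leqnn N))/= MN] := cvgr_lt _ (cvg_geometric M q1) _ e0.
by exists N.
Qed.

(** Iterating the step gives continuous [h n] with [u - h n] and [v + h n] at most
    [r n = M * (2 / 3) ^+ n]; their increments are summable, and the limit is the inserted
    function. *)
Let insertion_upper u v (M : R) :
  upper_semicontinuous (fun t => (u t)%:E) ->
  upper_semicontinuous (fun t => (v t)%:E) ->
  0 < M -> (forall t, u t + v t <= 0) ->
  (forall t, u t <= M) -> (forall t, v t <= M) ->
  exists g, [/\ continuous g, forall t, u t <= g t & forall t, v t <= - g t].
Proof.
move=> su sv M0 uv uM vM; pose r n : R := M * (2 / 3) ^+ n.
have r0 n : 0 < r n by rewrite mulr_gt0// exprn_gt0//; lra.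
have rS n : r n.+1 = 2 / 3 * r n by rewrite /r exprS mulrCA.
pose P n h := [/\ continuous h, forall t, u t - h t <= r n
  & forall t, v t + h t <= r n].
(* The premise [P p.1 p.2] sits under the existential, so choice yields a total [F] that can be
   iterated by recursion. *)
have /choice[F FP] (p : nat * (K -> R)) : exists h', P p.1 p.2 ->
    P p.1.+1 h' /\ forall t, `|h' t - p.2 t| <= 3^-1 * r p.1.
  case: p => n h /=.
  have [Pnh|] := pselect (P n h); last by exists h.
  have [ch uh vh] := Pnh.
  have ch' : continuous (fun t => - h t) by move=> t; apply: cvgN; exact: ch.
  (* The functions [u - h] and [v + h] again have sum [u + v <= 0], so the step applies with bound
     [r n]. *)
  have [|g [cg gr ug vg]] := insertion_step (upper_semicontinuousD su ch')
    (upper_semicontinuousD sv ch) (r0 n) _ uh vh.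
    by move=> t; have := uv t; lra.
  exists (fun t => h t + g t) => _; split; last by move=> t; rewrite addrC addKr.
  split=> t; first by apply: cvgD; [exact: ch | exact: cg].
    by rewrite rS; have := ug t; lra.
  by rewrite rS; have := vg t; lra.
pose fix h n := if n is n'.+1 then F (n', h n') else cst 0.
have hP n : P n (h n).
  elim: n => [|n ih]; last by have [] := FP (n, h n) ih.
  split=> t; first exact: cvg_cst.
    by rewrite subr0 /r expr0 mulr1.
  by rewrite addr0 /r expr0 mulr1.
have hS n t : `|h n.+1 t - h n t| <= 3^-1 * r n.
  by have [_ +] := FP (n, h n) (hP n); exact.
(* [h n + r n] decreases and [h n - r n] increases, so an infimum replaces the
   uniform limit. *)
pose U t n := h n t + r n.
have U_decr t n k : U t (n + k)%N <= U t n.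
  elim: k => [|k]; rewrite ?addn0// addnS; apply: le_trans.
  (* The increment of [h] is at most a third of the current [r], which is exactly the drop of [r] to
     the next index. *)
  by have := hS (n + k)%N t; rewrite /U rS ler_norml => /andP[_]; lra.
have L_incr t n k : h n t - r n <= h (n + k)%N t - r (n + k)%N.
  elim: k => [|k]; rewrite ?addn0// addnS => /le_trans; apply.
  by have := hS (n + k)%N t; rewrite rS ler_norml => /andP[+ _]; lra.
have LU t n m : h n t - r n <= U t m.
  have := L_incr t n m; have := U_decr t m n; rewrite addnC /U.
  by have := r0 (n + m)%N; lra.
pose g t := inf (range (U t)).
have gU t n : g t <= U t n.
  by apply: ge_inf; [exists (h 0 t - r 0) => _ [m _ <-] | exists n].
have Lg t n : h n t - r n <= g t.
  by apply: lb_le_inf; [exists (U t 0), 0 | move=> _ [m _ <-]].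
exists g; split=> t.
(* At both points [g] is within [r n < e / 3] of [h n]; continuity of [h n] supplies the remaining
   third. *)
- apply/cvgrPdist_lt => e e0; have e3 : 0 < e / 3 by lra.
  have [n rn] := geometric_small M0 e3; rewrite -/(r n) in rn.
  have [/(_ t)/cvgrPdist_lt/(_ _ e3) ch _ _] := hP n.
  apply: filterS ch => s; rewrite !ltr_norml.
  have := gU t n; have := Lg t n; have := gU s n; have := Lg s n.
  by rewrite /U => ? ? ? ? /andP[? ?]; apply/andP; split; lra.
- apply: lb_le_inf; first by exists (U t 0), 0.
  by move=> _ [n _ <-]; have [_ /(_ t) + _] := hP n; rewrite /U; lra.
(* For every [n], [v + g <= (v + h n) + r n <= 2 * r n], which rules out a positive value. *)
- rewrite leNgt; apply/negP => vg.
  have vg2 : 0 < (v t + g t) / 2 by lra.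
  have [n rn] := geometric_small M0 vg2; rewrite -/(r n) in rn.
  by have [_ _ /(_ t)] := hP n; have := gU t n; rewrite /U; lra.
Qed.

Lemma katetov_tong_insertion u l (M : R) :
  upper_semicontinuous (fun t => (u t)%:E) ->
  lower_semicontinuous (fun t => (l t)%:E) ->
  (forall t, u t <= l t) -> (forall t, u t <= M) -> (forall t, - M <= l t) ->
  exists g, [/\ continuous g, forall t, u t <= g t & forall t, g t <= l t].
Proof.
move=> su /lower_semicontinuousN sl ul uM lM.
(* The bound [|M| + 1] is positive whatever the sign of [M], as the iteration requires. *)
have [] := @insertion_upper u (fun t => - l t) (`|M| + 1) su sl.
- by rewrite ltr_wpDl.
- by move=> t; rewrite subr_le0.
- by move=> t; have := ler_norm M; have := uM t; lra.
- by move=> t; have := ler_norm M; have := lM t; lra.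
by move=> g [cg ug gl]; exists g; split=> // t; rewrite -lerN2.
Qed.

End insertion.

(** * Semicontinuity, distance estimates and duality for envelopes *)

Section envelope_estimates.
Context {R : realType} {K : topologicalType} (F : nat -> K -> R) (M : R).
Hypothesis F_bounded : forall n t, `|F n t| <= M.

Lemma upper_envelope_ge (t : K) (c : R) :
  (\forall n \near \oo, c <= F n t) -> c <= upper_envelope F t.
Proof.
move=> cF; rewrite leNgt; apply/negP => /(upper_envelope_lt F_bounded).
case=> -[U V] /= [Ut Voo UV].
near \oo => n.
have : F n t < c.
  by apply: (UV (t, n)); split; [exact: nbhs_singleton | near: n].
by apply/negP; rewrite -leNgt; near: n.
Unshelve. all: by end_near. Qed.

Lemma normr_upper_envelope_le (t : K) : `|upper_envelope F t| <= M.
Proof.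
have FM n s : - M <= F n s <= M by rewrite -ler_norml.
rewrite ler_norml; apply/andP; split.
  by apply: upper_envelope_ge; near=> n; case/andP: (FM n t).
by apply: (upper_envelope_le F_bounded); near=> s n; case/andP: (FM n s).
Unshelve. all: by end_near. Qed.

Lemma upper_envelope_usc : upper_semicontinuous (fun t => (upper_envelope F t)%:E).
Proof.
apply/upper_semicontinuous_nearP => t c btc.
(* A bound [F n s < d] yields only [<= d] for the envelope; [d < c] restores strictness. *)
pose d := (upper_envelope F t + c) / 2.
have btd : upper_envelope F t < d by rewrite /d; lra.
have [[U V] /= [Ut Voo] UV] := upper_envelope_lt F_bounded btd.
near=> s; apply: (@le_lt_trans _ _ d); last by rewrite /d; lra.
apply: (upper_envelope_le F_bounded); exists (U, V); last by move=> p /UV/ltW.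
by split=> //=; near: s; exact: nbhs_interior.
Unshelve. all: by end_near. Qed.

(** The lower half uses only values at [t]; the upper half uses a neighbourhood on which
    [g < g t + e]. *)
Lemma upper_envelope_dist_le (g : K -> R) (c : R) (t : K) : continuous g ->
  (\forall n \near \oo, forall s, `|F n s - g s| <= c) ->
  `|upper_envelope F t - g t| <= c.
Proof.
move=> cg Fg; rewrite ler_norml; apply/andP; split.
  rewrite lerBrDr; apply: upper_envelope_ge; apply: filterS Fg => n /(_ t).
  by rewrite ler_norml => /andP[+ _]; rewrite lerBrDr.
apply/ler_addgt0Pr => e e0; rewrite lerBlDr.
apply: (upper_envelope_le F_bounded).
have gte : g t < g t + e by lra.
exists ([set s | g s < g t + e], [set n | forall s, `|F n s - g s| <= c]).
  by split=> //=; exact: (cvgr_lt _ (cg t)).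
by move=> [s n] [/= gs /(_ s)]; rewrite ler_norml => /andP[_]; lra.
Qed.

(** Around each [t] the bound holds for [s] near [t] and all large [n]; compactness in its
    near-covering form makes the threshold on [n] uniform in [s]. *)
Lemma upper_envelope_uniform_lt (g : K -> R) (c : R) :
  compact [set: K] -> continuous g ->
  (forall t, upper_envelope F t - g t < c) ->
  \forall n \near \oo, forall s, F n s - g s < c.
Proof.
move=> /compact_near_coveringP cK cg bg.
have near_lt t : [set: K] t ->
    \forall s \near t & n \near \oo, F n s - g s < c.
  move=> _; have btc := bg t.
  pose e := (c - (upper_envelope F t - g t)) / 2.
  have bte : upper_envelope F t < upper_envelope F t + e by rewrite /e; lra.
  have gte : g t - e < g t by rewrite /e; lra.
  have [[U V] /= [Ut Voo] UV] := upper_envelope_lt F_bounded bte.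
  exists (U `&` [set s | g t - e < g s], V).
    by split=> //=; apply: filterI => //; exact: (cvgr_gt _ (cg t)).
  move=> [s n] [[/= Us gs] Vn]; have /= := UV (s, n) (conj Us Vn).
  by rewrite /e in gs *; lra.
have cF := cK nat \oo (fun n s => F n s - g s < c) eventually_filter near_lt.
by apply: filterS cF => n Fn s; exact: Fn.
Qed.

(** Transfers results on upper envelopes to lower ones; the sign passes through [lim] because the
    tail suprema of [- F] converge. *)
Lemma lower_envelopeE (t : K) :
  lower_envelope F t = - upper_envelope (fun n s => - F n s) t.
Proof.
have NF_bounded n s : `|- F n s| <= M by rewrite normrN.
have liminfE (D : directed_set) (x : D -> K) :
    net_liminf F x = - net_limsup (fun n s => - F n s) x.
  rewrite /net_liminf /net_limsup -limN; last exact: (is_cvg_tail_sup NF_bounded).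
  apply: (congr1 (fun h => lim (h @ tails (prod_directed nat_directed D)))).
  apply/funext => p /=; congr (- sup _).
  by rewrite image_comp.
rewrite /lower_envelope /upper_envelope /inf; congr (- sup _).
apply/seteqP; split=> [_ [_ [D [x [xt ->]]] <-]|_ [D [x [xt ->]]]].
  by exists D, x; split=> //; rewrite liminfE opprK.
exists (net_liminf F x); last by rewrite liminfE opprK.
by exists D, x.
Qed.

End envelope_estimates.

(** Otherwise the values at [t] eventually lie below the midpoint [c] of the two envelopes, which
    forces the lower one to be at most [c], although it exceeds [c]. *)
Lemma lower_envelope_le_upper {R : realType} {K : topologicalType}
    (F : nat -> K -> R) (M : R) (t : K) :
  (forall n s, `|F n s| <= M) -> lower_envelope F t <= upper_envelope F t.
Proof.
move=> FM; have NFM n s : `|- F n s| <= M by rewrite normrN.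
rewrite (lower_envelopeE FM) leNgt; apply/negP => ba.
pose c := (upper_envelope F t - upper_envelope (fun n s => - F n s) t) / 2.
have bc : upper_envelope F t < c by rewrite /c; lra.
have : - c <= upper_envelope (fun n s => - F n s) t.
  apply: (upper_envelope_ge NFM).
  have [[U V] /= [Ut Voo] UV] := upper_envelope_lt FM bc.
  apply: filterS Voo => n Vn; rewrite lerN2.
  by apply/ltW/(UV (t, n)); split=> //; exact: nbhs_singleton.
by rewrite /c in bc *; lra.
Qed.

(** * Eventual bounds and the limsup of a bounded real sequence *)

Section limn_sup_bounds.
Context {R : realType} (u : nat -> R).
Hypothesis u_bounded : bounded_fun u.

Let sdrop_ub n : has_ubound (sdrop u n).
Proof. exact/has_ubound_sdrop/bounded_fun_has_ubound. Qed.

Lemma limn_sup_le (c : R) :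
  (\forall n \near \oo, u n <= c) -> limn_sup u <= c.
Proof.
move=> [N _ uc]; rewrite limn_supE//; apply: (@le_trans _ _ (sups u N)).
  by apply: ge_inf; [exact: bounded_fun_has_lbound_sups | exists N].
by apply: ge_sup; [exists (u N), N => /= | move=> _ [n Nn <-]; exact: uc].
Qed.

Lemma limn_sup_lt (c : R) :
  limn_sup u < c -> \forall n \near \oo, u n < c.
Proof.
rewrite limn_supE// => uc.
have [|_ [N _ <-] Nc] := inf_lt _ uc; first by exists (sups u 0), 0.
exists N => // n Nn /=; apply: le_lt_trans Nc.
by apply: ub_le_sup; [exact: sdrop_ub | exists n].
Qed.

End limn_sup_bounds.

(** * Supremum norms of bounded, possibly discontinuous functions *)

Section sup_norm_bounded.
Context {R : realType} {T : Type} (h : T -> R) (M : R).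
Hypothesis h_bounded : forall t, `|h t| <= M.

Lemma normr_le_sup_norm (t : T) : `|h t| <= sup_norm h.
Proof. by apply: ub_le_sup; [exists M => _ [s _ <-] | exists t]. Qed.

Lemma sup_norm_bounded_ge0 : 0 <= sup_norm h.
Proof.
have [[t]|T0] := pselect (inhabited T).
  exact: le_trans (normr_ge0 _) (normr_le_sup_norm t).
rewrite /sup_norm; suff -> : range (fun t => `|h t|) = set0 by rewrite sup0.
by rewrite -subset0 => r [t _ _]; apply: T0; exists; exact: t.
Qed.

End sup_norm_bounded.

(** * The limsup formula and the midpoint function *)

Section asymptotic_distance.
Context {R : realType} {K : topologicalType} (cK : compact [set: K]).
Variables (f : nat -> C cK R) (M : R).
Hypothesis f_bounded : forall n, `|f n| <= M.

Let F n : K -> R := f n.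
Let a := lower_envelope F.
Let b := upper_envelope F.

Let F_bounded n t : `|F n t| <= M.
Proof. exact: le_trans (C_norm_ge (f n) t) (f_bounded n). Qed.

Let NF_bounded n t : `|- F n t| <= M.
Proof. by rewrite normrN. Qed.

Let b_bounded t : `|b t| <= M.
Proof. exact: normr_upper_envelope_le. Qed.

Let a_bounded t : `|a t| <= M.
Proof. by rewrite /a (lower_envelopeE F_bounded) normrN normr_upper_envelope_le. Qed.

Lemma dist_upper_envelope_bounded (g : C cK R) t : `|b t - g t| <= M + `|g|.
Proof. exact: le_trans (ler_normB _ _) (lerD (b_bounded t) (C_norm_ge g t)). Qed.

Lemma dist_lower_envelope_bounded (g : C cK R) t : `|g t - a t| <= M + `|g|.
Proof.
rewrite distrC.
exact: le_trans (ler_normB _ _) (lerD (a_bounded t) (C_norm_ge g t)).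
Qed.

Lemma envelope_gap_bounded t : `|b t - a t| <= M + M.
Proof. exact: le_trans (ler_normB _ _) (lerD (b_bounded t) (a_bounded t)). Qed.

Lemma dist_bounded (g : C cK R) : bounded_fun (fun n => `|f n - g|).
Proof.
exists (M + `|g|); split; first exact: num_real.
move=> x Mx n _ /=; rewrite normr_id; apply: le_trans (ltW Mx).
exact: le_trans (ler_normB _ _) (lerD (f_bounded n) (lexx _)).
Qed.

(** Eventually [f n] is uniformly within [L + e] of [g], and this bound passes to both envelopes, to
    [a] through [- f n] and [- g]. *)
Lemma limn_sup_dist_ge (g : C cK R) :
  Num.max (sup_norm (fun t => b t - g t)) (sup_norm (fun t => g t - a t)) <=
    limn_sup (fun n => `|f n - g|).
Proof.
set L := limn_sup _; apply/ler_addgt0Pr => e e0.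
have LLe : L < L + e by lra.
have near_le : \forall n \near \oo, `|f n - g| <= L + e.
  by apply: filterS (limn_sup_lt (dist_bounded g) LLe) => n /ltW.
have Le0 : 0 <= L + e.
  by near \oo => n; apply: (@le_trans _ _ `|f n - g|) => //; near: n.
have cg : continuous (g : K -> R) by move=> t; exact: cts_fun.
have cNg : continuous (fun t => - g t) by move=> t; apply: cvgN; exact: cg.
rewrite ge_max; apply/andP; split; apply: sup_norm_le => // t.
  apply: (upper_envelope_dist_le F_bounded) => //.
  by apply: filterS near_le => n fg s; exact: le_trans (C_norm_ge (f n - g) s) fg.
have -> : g t - a t = upper_envelope (fun n s => - F n s) t - - g t.
  by rewrite /a (lower_envelopeE F_bounded) !opprK addrC.
apply: (@upper_envelope_dist_le _ _ _ _ NF_bounded (fun t => - g t)) => //.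
apply: filterS near_le => n fg s; rewrite -opprD normrN.
exact: le_trans (C_norm_ge (f n - g) s) fg.
Unshelve. all: by end_near. Qed.

(** Uniform one-sided bounds for [f n - g] and for its negative, obtained from [b] and [a]
    respectively, combine into a bound on the norm. *)
Lemma limn_sup_dist_le (g : C cK R) :
  limn_sup (fun n => `|f n - g|) <=
    Num.max (sup_norm (fun t => b t - g t)) (sup_norm (fun t => g t - a t)).
Proof.
set m := Num.max _ _; apply/ler_addgt0Pr => e e0.
have cg : continuous (g : K -> R) by move=> t; exact: cts_fun.
have cNg : continuous (fun t => - g t) by move=> t; apply: cvgN; exact: cg.
have m0 : 0 <= m.
  by rewrite le_max (sup_norm_bounded_ge0 (dist_upper_envelope_bounded g)).
have upper : \forall n \near \oo, forall s, F n s - g s < m + e.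
  apply: (upper_envelope_uniform_lt F_bounded) => // t.
  apply: (@le_lt_trans _ _ m); last by lra.
  rewrite le_max; apply/orP; left; apply: le_trans (ler_norm _) _.
  exact: (normr_le_sup_norm (dist_upper_envelope_bounded g)).
have lower : \forall n \near \oo, forall s, - F n s - - g s < m + e.
  apply: (upper_envelope_uniform_lt NF_bounded) => // t.
  have -> : upper_envelope (fun n s => - F n s) t - - g t = g t - a t.
    by rewrite /a (lower_envelopeE F_bounded) !opprK addrC.
  apply: (@le_lt_trans _ _ m); last by lra.
  rewrite le_max; apply/orP; right; apply: le_trans (ler_norm _) _.
  exact: (normr_le_sup_norm (dist_lower_envelope_bounded g)).
apply: (limn_sup_le (dist_bounded g)); near=> n.
apply: sup_norm_le => [|s]; first by lra.
rewrite ler_norml; apply/andP; split; last first.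
  by apply/ltW; move: s; near: n.
have : - F n s - - g s < m + e by move: s; near: n.
have -> : (f n - g) s = F n s - g s by [].
by lra.
Unshelve. all: by end_near. Qed.

(** Triangle inequality through [g]. Separate [c] and [d] allow a bound on one distance to force a
    lower bound on the other. *)
Lemma envelope_gap_le (g : C cK R) (c d : R) :
  sup_norm (fun t => b t - g t) <= c -> sup_norm (fun t => g t - a t) <= d ->
  sup_norm (fun t => b t - a t) <= c + d.
Proof.
move=> bc ad; apply: sup_norm_le => [|t].
  have := sup_norm_bounded_ge0 (dist_upper_envelope_bounded g).
  have := sup_norm_bounded_ge0 (dist_lower_envelope_bounded g); lra.
rewrite -(subrKA (g t)); apply: le_trans (ler_normD _ _) _.
apply: lerD.
  exact: le_trans (normr_le_sup_norm (dist_upper_envelope_bounded g) t) bc.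
exact: le_trans (normr_le_sup_norm (dist_lower_envelope_bounded g) t) ad.
Qed.

(** Since [b - a <= 2 * r], a continuous [g] fits between [b - r] and [a + r]; the two opposite
    inequalities follow from [a <= b]. *)
Lemma exists_midpoint : hausdorff_space K ->
  exists g : C cK R,
    sup_norm (fun t => b t - g t) <= 2^-1 * sup_norm (fun t => b t - a t) /\
    sup_norm (fun t => g t - a t) <= 2^-1 * sup_norm (fun t => b t - a t).
Proof.
move=> hK; set r := 2^-1 * _.
have r0 : 0 <= r by rewrite mulr_ge0// (sup_norm_bounded_ge0 envelope_gap_bounded).
have ab t : 0 <= b t - a t <= r + r.
  rewrite subr_ge0 (lower_envelope_le_upper t F_bounded)/=.
  have := normr_le_sup_norm envelope_gap_bounded t.
  by have := ler_norm (b t - a t); rewrite /r; lra.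
have su : upper_semicontinuous (fun t => (b t + - r)%:E).
  apply: upper_semicontinuousD; first exact: upper_envelope_usc F_bounded.
  by move=> t; exact: cvg_cst.
have sl : lower_semicontinuous (fun t => (a t + r)%:E).
  apply/lower_semicontinuousN.
  under eq_fun do rewrite opprD /a (lower_envelopeE F_bounded) opprK.
  apply: upper_semicontinuousD; first exact: upper_envelope_usc NF_bounded.
  by move=> t; exact: cvg_cst.
have aM t : - M <= a t by have := a_bounded t; rewrite ler_norml => /andP[].
have bM t : b t <= M by exact: le_trans (ler_norm _) (b_bounded t).
have [||| g [cg bg ga]] :=
  katetov_tong_insertion (compact_normal hK cK) (M := M) su sl.
- by move=> t; have /andP[_] := ab t; lra.
- by move=> t; have := bM t; lra.
- by move=> t; have := aM t; lra.
exists (mkcts cg : C cK R); split; apply: sup_norm_le => // t.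
  change (`|b t - g t| <= r); rewrite ler_norml.
  have := bg t; have := ga t; have /andP[ab1 ab2] := ab t.
  by move=> ? ?; apply/andP; split; lra.
change (`|g t - a t| <= r); rewrite ler_norml.
have := bg t; have := ga t; have /andP[ab1 ab2] := ab t.
by move=> ? ?; apply/andP; split; lra.
Qed.

End asymptotic_distance.

Theorem theorem2p3 (R : realType) (K : topologicalType)
    (hK : hausdorff_space K) (cK : compact [set: K])
    (f : nat -> C cK R) (bf : bounded_fun f) :
  let a : K -> R := lower_envelope (fun n => f n : K -> R) in
  let b : K -> R := upper_envelope (fun n => f n : K -> R) in
  lower_semicontinuous (fun t => (a t)%:E) /\
  upper_semicontinuous (fun t => (b t)%:E) /\
  (forall g : C cK R,
    limn_sup (fun n => `|f n - g|) =
      Num.max (sup_norm (fun t => b t - g t)) (sup_norm (fun t => g t - a t))) /\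
  asymptotic_radius f = 2^-1 * sup_norm (fun t => b t - a t) /\
  asymptotic_center f =
    [set g : C cK R |
      sup_norm (fun t => b t - g t) = 2^-1 * sup_norm (fun t => b t - a t) /\
      sup_norm (fun t => g t - a t) = 2^-1 * sup_norm (fun t => b t - a t)] /\
  asymptotic_center f !=set0.
Proof.
move=> a b.
have [M fM] : exists M, forall n, `|f n| <= M.
  (* [bounded_fun] provides a bound only for numbers strictly above its [M], hence [M + 1]. *)
  by have [M [_ fM]] := bf; exists (M + 1) => n; apply: fM; rewrite ?ltrDl.
have FM n t : `|f n t| <= M := le_trans (C_norm_ge (f n) t) (fM n).
have NFM n t : `|- f n t| <= M by rewrite normrN.
have distE g : limn_sup (fun n => `|f n - g|) =
    Num.max (sup_norm (fun t => b t - g t)) (sup_norm (fun t => g t - a t)).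
  by apply/eqP; rewrite eq_le (limn_sup_dist_le fM) (limn_sup_dist_ge fM).
set r := 2^-1 * sup_norm (fun t => b t - a t).
have gap_le (g : C cK R) c d : sup_norm (fun t => b t - g t) <= c ->
    sup_norm (fun t => g t - a t) <= d -> r + r <= c + d.
  by move=> bc ad; have := envelope_gap_le fM bc ad; rewrite -/a -/b /r; lra.
have r_le (g : C cK R) : r <= limn_sup (fun n => `|f n - g|).
  (* Both distances are at most the limsup, so the gap estimate gives [2 * r] at most twice the
     limsup. *)
  have bg := lexx (limn_sup (fun n => `|f n - g|)).
  rewrite {1}distE ge_max in bg; have /andP[bg1 bg2] := bg.
  by have := gap_le g _ _ bg1 bg2; lra.
have [g0 [bg0 ga0]] := exists_midpoint fM hK.
have radiusE : asymptotic_radius f = r.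
  apply/eqP; rewrite eq_le; apply/andP; split.
    apply: (@le_trans _ _ (limn_sup (fun n => `|f n - g0|))).
      by apply: ge_inf; [exists r => _ [g _ <-] | exists g0].
    by rewrite distE ge_max; apply/andP.
  apply: lb_le_inf; last by move=> _ [g _ <-].
  by exists (limn_sup (fun n => `|f n - g0|)), g0.
have centerE : asymptotic_center f = [set g : C cK R |
    sup_norm (fun t => b t - g t) = r /\ sup_norm (fun t => g t - a t) = r].
  apply/seteqP; split=> g; rewrite /asymptotic_center /= distE radiusE.
    (* A maximum equal to [r] bounds both distances by [r]; the gap estimate then forbids either
       from being smaller. *)
    move=> gr; have := lexx r; rewrite -{1}gr ge_max => /andP[bg ga].
    have := gap_le g _ _ bg (lexx _); have := gap_le g _ _ (lexx _) ga.
    by move=> ? ?; split; lra.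
  by move=> [-> ->]; rewrite maxxx.
split; last split; last split=> //; last split=> //; last split=> //.
- apply/lower_semicontinuousN; under eq_fun do rewrite /a (lower_envelopeE FM) opprK.
  exact: upper_envelope_usc NFM.
- exact: upper_envelope_usc FM.
exists g0; rewrite centerE /=.
have := gap_le g0 _ _ bg0 (lexx _); have := gap_le g0 _ _ (lexx _) ga0.
by move: bg0 ga0; rewrite -/a -/b -/r => *; split; lra.
Qed.
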